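(* Let $k,n\in\mathbb{N}$ satisfy $\gcd(k,n)>1$. Then the function $f:\mathbb{F}_{2^n}\to\mathbb{F}_{2^n}$ given by $f(x)=x^{2^{2k}+2^k+1}$ has maximal second-order differential uniformity, i.e. $\delta^2(f)=2^n$.
   Context: $\mathbb{N}=\{1,2,3,\dots\}$; $\mathbb{F}_{2^n}$ is the finite field with $2^n$ elements and $\mathbb{F}_{2^n}^*$ its set of non-zero elements. For $f:\mathbb{F}_{2^n}\to\mathbb{F}_{2^n}$ and $a\in\mathbb{F}_{2^n}^*$, the discrete derivative is $D_af(x)=f(x+a)-f(x)$, and $D^{(2)}_{a,b}f=D_aD_bf$, i.e. $D^{(2)}_{a,b}f(x)=f(x)+f(x+a)+f(x+b)+f(x+a+b)$. The second-order differential uniformity of $f$ is $$\delta^2(f)=\max_{a,b\in\mathbb{F}_{2^n}^*,\ a\neq b,\ c\in\mathbb{F}_{2^n}}\left|\{x\in\mathbb{F}_{2^n} : D^{(2)}_{a,b}f(x)=c\}\right|.$$ *)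

(* Defs.v *)
From HB Require Import structures.
From mathcomp Require Import all_boot all_order all_algebra all_field.

Set Implicit Arguments.
Unset Strict Implicit.
Unset Printing Implicit Defensive.

Import GRing.Theory.
Local Open Scope ring_scope.

Definition discrete_derivative (V : zmodType) (a : V) (f : V -> V) : V -> V :=
  fun x => f (x + a) - f x.

Definition second_derivative (V : zmodType) (a b : V) (f : V -> V) : V -> V :=
  discrete_derivative a (discrete_derivative b f).

(* The maximum is taken in nat and is 0 when there is no pair of distinct
   nonzero elements, i.e. when F has two elements. *)
Definition second_order_differential_uniformity
    (F : finFieldType) (f : F -> F) : nat :=
  \max_(a : F | a != 0%R)
    \max_(b : F | (b != 0%R) && (a != b))
      \max_(c : F) #|[set x : F | second_derivative a b f x == c]|.

(* Main.v *)
(* If a and b are fixed by the Frobenius power x |-> x ^+ q with q = 2 ^ k, then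
   f (x + t) = (x ^+ (q ^ 2) + t)(x ^+ q + t)(x + t) for t = a, b, a + b. The
   maps t |-> t and t |-> t ^+ 2 are additive in characteristic 2, so only the
   t ^+ 3 part survives two derivations and D_a D_b f is the constant
   a b (a + b). Such nonzero a != b exist: take a = 1 and b of prime order
   dividing 2 ^ gcd(k, n) - 1. *)
Require Import Defs.
From HB Require Import structures.
From mathcomp Require Import all_boot all_order all_algebra all_field.
From mathcomp Require Import all_fingroup all_solvable.
From mathcomp Require Import ring.

Set Implicit Arguments.
Unset Strict Implicit.
Unset Printing Implicit Defensive.

Import GRing.Theory.
Local Open Scope ring_scope.

(** As [d] divides both [n] and [k], the prime [p] divides 2^n - 1, so Cauchy gives a unit of order
    [p], and 2^k - 1, so this unit is fixed. *)
Lemma exists_frobenius_fixed (k n : nat) (F : finFieldType) :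
  #|F| = (2 ^ n)%N -> (1 < gcdn k n)%N ->
  exists b : F, [/\ b != 0, b != 1 & b ^+ (2 ^ k) = b].
Proof.
move=> hF; set d := gcdn k n => hd.
have dvd_pred m : (d %| m)%N -> ((2 ^ d).-1 %| (2 ^ m).-1)%N.
  by case/dvdnP=> j ->; rewrite mulnC expnM dvdn_pred_predX.
(* From [d] > 1, 2^d - 1 is at least 3 and so has a prime divisor. *)
have gt1 : (1 < (2 ^ d).-1)%N.
  by rewrite -ltnS prednK ?expn_gt0 // (leq_trans _ (leq_pexp2l _ hd)).
have p_pr := pdiv_prime gt1; set p := pdiv _ in p_pr.
have p_dvd m : (d %| m)%N -> (p %| (2 ^ m).-1)%N.
  by move=> /dvd_pred; apply: dvdn_trans; apply: pdiv_dvd.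
have p_dvdF : (p %| #|[set: {unit F}]|)%N.
  by rewrite card_finField_unit hF p_dvd ?dvdn_gcdr.
have [u _ ou] := Cauchy p_pr p_dvdF.
exists (val u); split.
- by rewrite -unitfE; apply: valP.
- apply/eqP=> u1; have u1g : u = 1%g by apply: val_inj.
  by move: p_pr; rewrite -ou u1g order1.
- have /eqP uk : (u ^+ (2 ^ k).-1 == 1)%g.
    by rewrite -order_dvdn ou p_dvd ?dvdn_gcdl.
  by rewrite -[(2 ^ k)%N]prednK ?expn_gt0 // exprS -FinRing.val_unitX uk mulr1.
Qed.

Lemma second_derivative_frobenius_fixed (k : nat) (F : fieldType) (a b x : F) :
  2%N \in [pchar F] -> a ^+ (2 ^ k) = a -> b ^+ (2 ^ k) = b ->
  second_derivative a b
    (fun x : F => x ^+ (2 ^ (2 * k) + 2 ^ k + 1)%N) x = a * b * (a + b).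
Proof.
move=> char2 ak bk.
have frobD (y z : F) : (y + z) ^+ (2 ^ k) = y ^+ (2 ^ k) + z ^+ (2 ^ k).
  by apply: exprDn_pchar; rewrite pnatX (eq_pnat _ (pcharf_eq char2)) pnat_id.
have fE (y : F) : y ^+ (2 ^ (2 * k) + 2 ^ k + 1)
    = (y ^+ (2 ^ k)) ^+ (2 ^ k) * y ^+ (2 ^ k) * y.
  by rewrite !exprD expr1 mul2n -addnn expnD exprM.
rewrite /second_derivative /discrete_derivative !fE !frobD !ak !bk.
set y := x ^+ _; set z := y ^+ _.
have two0 : (2 : F) = 0 by apply: pcharf0.
(* Before reduction mod 2, the t^2 and t^3 parts give 2ab(x + y + z) and 3ab(a + b); the even excess
   is split off. *)
transitivity (a * b * (a + b) + 2 * (a * b * (x + y + z + a + b))); first by ring.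
by rewrite two0 mul0r addr0.
Qed.

Theorem proposition3p2 (k n : nat) (F : finFieldType)
    (hk : (0 < k)%N) (hn : (0 < n)%N)
    (hF : #|F| = (2 ^ n)%N)
    (hkn : (1 < gcdn k n)%N) :
  second_order_differential_uniformity
    (fun x : F => x ^+ (2 ^ (2 * k) + 2 ^ k + 1)%N) = (2 ^ n)%N.
Proof.
have [b [b0 b1 bk]] := exists_frobenius_fixed hF hkn.
have char2 : 2%N \in [pchar F] by apply: card_finPcharP hF _.
apply/eqP; rewrite eqn_leq -hF; apply/andP; split.
  by do 3![apply/bigmax_leqP=> ? _]; apply: max_card.
(* Lower bound: with a = 1 and c the constant value of the derivative, the solution set is all of
   [F]. *)
apply: (bigmax_sup 1); first exact: oner_neq0.
apply: (bigmax_sup b); first by rewrite b0 eq_sym.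
apply: (bigmax_sup (1 * b * (1 + b))) => //.
rewrite -cardsT subset_leq_card //; apply/subsetP=> x _; rewrite inE.
by rewrite second_derivative_frobenius_fixed ?expr1n.
Qed.
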